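(* For each of the three detailed profiles $$\mathbf p\in\{(1,0,0;1,2,2;3),\ (1,1,0;1,2,1;3),\ (1,1,0;1,2,2;2)\}$$ there is a nonempty Euclidean-open set $\mathcal V_{\mathbf p}\subset\mathbb{R}^{3\times 3}$ such that every matrix in $\mathcal V_{\mathbf p}$ has $9$ distinct regular Pareto eigenvalues and admits an assigned support map with detailed profile $\mathbf p$.
   Context: Vector inequalities are componentwise ($u>0$ means all components are positive). For $A\in\mathbb{R}^{n\times n}$, a real number $\lambda$ is a Pareto eigenvalue of $A$ if there is $x\in\mathbb{R}^n\setminus\{0\}$ with $x\ge 0$, $Ax-\lambda x\ge 0$ and $\langle x,Ax-\lambda x\rangle=0$. The set of Pareto eigenvalues is $\Pi(A)$. A support is a nonempty subset $J\subseteq\{1,\dots,n\}$, with complement $J^{\mathrm c}$; $A_J$ is the principal submatrix indexed by $J$ and $A_{J^{\mathrm c},J}$ is the submatrix with rows in $J^{\mathrm c}$ and columns in $J$. The support $J$ produces $\lambda\in\mathbb{R}$ if there is $u\in\mathbb{R}^{|J|}$ with $A_Ju=\lambda u$, $u>0$, $A_{J^{\mathrm c},J}u\ge 0$. The set of values produced by $J$ is $\Pi_J(A)$; one has $\Pi(A)=\bigcup_J\Pi_J(A)$. A value $\lambda\in\Pi_J(A)$ is regularly produced by $J$ if it is an algebraically simple eigenvalue of $A_J$ and every component of $A_{J^{\mathrm c},J}u$ is positive, where $u$ is the vector above (the second condition is empty if $J=\{1,\dots,n\}$). A Pareto eigenvalue is regular if it is regularly produced by at least one support. An assigned support map for $A$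 is a map $\tau$ from $\Pi(A)$ to the set of supports such that $\lambda\in\Pi_{\tau(\lambda)}(A)$ for every $\lambda\in\Pi(A)$. Put $m_J:=|\{\lambda\in\Pi(A):\tau(\lambda)=J\}|$. For $n=3$ the detailed (assigned) profile is $(m_1,m_2,m_3;m_{12},m_{13},m_{23};m_{123})$, where $m_i=m_{\{i\}}$, $m_{ij}=m_{\{i,j\}}$, $m_{123}=m_{\{1,2,3\}}$. *)

(* Defs.v *)
From HB Require Import structures.
From mathcomp Require Import all_boot all_order all_algebra.
From mathcomp Require Import all_classical all_reals all_analysis.
Import Order.TTheory GRing.Theory Num.Theory.
Import numFieldNormedType.Exports.

Set Implicit Arguments.
Unset Strict Implicit.
Unset Printing Implicit Defensive.

Local Open Scope classical_set_scope.
Local Open Scope card_scope.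
Local Open Scope ring_scope.

Definition vnonneg (R : numDomainType) (n : nat) (u : 'cV[R]_n) : Prop :=
  forall i, 0 <= u i 0.

Definition vpos (R : numDomainType) (n : nat) (u : 'cV[R]_n) : Prop :=
  forall i, 0 < u i 0.

Definition dotv (R : numDomainType) (n : nat) (u v : 'cV[R]_n) : R :=
  \sum_i u i 0 * v i 0.

Definition pareto_eigenvalue (R : realType) (n : nat) (A : 'M[R]_n) (l : R) :
    Prop :=
  exists x : 'cV[R]_n, [/\ x != 0, vnonneg x, vnonneg (A *m x - l *: x)
    & dotv x (A *m x - l *: x) = 0].

Definition pareto_spectrum (R : realType) (n : nat) (A : 'M[R]_n) : set R :=
  [set l | pareto_eigenvalue A l].

Definition is_support (n : nat) (J : {set 'I_n}) : Prop := J != finset.set0.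

(* The submatrix with rows in I and columns in J, each listed in increasing
   order. *)
Definition submx_on (R : realType) (n : nat) (A : 'M[R]_n) (I J : {set 'I_n}) :
    'M[R]_(#|I|, #|J|) :=
  mxsub (fun i : 'I_#|I| => enum_val i) (fun j : 'I_#|J| => enum_val j) A.

Definition produces_with (R : realType) (n : nat) (A : 'M[R]_n)
    (J : {set 'I_n}) (l : R) (u : 'cV[R]_#|J|) : Prop :=
  [/\ is_support J, submx_on A J J *m u = l *: u, vpos u
    & vnonneg (submx_on A (finset.setC J) J *m u)].

Definition produced_values (R : realType) (n : nat) (A : 'M[R]_n)
    (J : {set 'I_n}) : set R :=
  [set l | exists u : 'cV[R]_#|J|, produces_with A l u].

Definition regularly_produces (R : realType) (n : nat) (A : 'M[R]_n)
    (J : {set 'I_n}) (l : R) : Prop :=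
  exists u : 'cV[R]_#|J|, [/\ produces_with A l u,
    mup l (char_poly (submx_on A J J)) = 1%N
    & vpos (submx_on A (finset.setC J) J *m u)].

Definition regular_pareto_eigenvalue (R : realType) (n : nat) (A : 'M[R]_n)
    (l : R) : Prop :=
  pareto_eigenvalue A l /\
  exists J : {set 'I_n}, regularly_produces A J l.

(* Only the values of tau on the Pareto spectrum of A are relevant. *)
Definition assigned_support_map (R : realType) (n : nat) (A : 'M[R]_n)
    (tau : R -> {set 'I_n}) : Prop :=
  forall l, pareto_spectrum A l -> produced_values A (tau l) l.

(* The assertion m_J = m, which includes finiteness of the set being counted. *)
Definition assigned_multiplicity (R : realType) (n : nat) (A : 'M[R]_n)
    (tau : R -> {set 'I_n}) (J : {set 'I_n}) (m : nat) : Prop :=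
  [set l | pareto_spectrum A l /\ tau l = J] #= `I_m.

(* ((m_1, m_2, m_3), (m_12, m_13, m_23), m_123) *)
Definition profile3 : Type := ((nat * nat * nat) * (nat * nat * nat) * nat)%type.

(* The indices 1, 2, 3 of the mathematical text are 0, 1, 2 in 'I_3. *)
Definition has_detailed_profile (R : realType) (A : 'M[R]_3)
    (tau : R -> {set 'I_3}) (p : profile3) : Prop :=
  let: (m1, m2, m3, (m12, m13, m23), m123) := p in
  let i1 : 'I_3 := @Ordinal 3 0 isT in
  let i2 : 'I_3 := @Ordinal 3 1 isT in
  let i3 : 'I_3 := @Ordinal 3 2 isT in
  [/\ [/\ assigned_multiplicity A tau [set i1]%SET m1,
          assigned_multiplicity A tau [set i2]%SET m2
        & assigned_multiplicity A tau [set i3]%SET m3],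
      [/\ assigned_multiplicity A tau [set i1; i2]%SET m12,
          assigned_multiplicity A tau [set i1; i3]%SET m13
        & assigned_multiplicity A tau [set i2; i3]%SET m23]
    & assigned_multiplicity A tau [set i1; i2; i3]%SET m123].

(* Main.v *)
(* Each profile is realised near an explicit integer matrix A0. For every support J
   all |J| eigenvalues of A_J are real and lie in disjoint intervals with integer
   endpoints, which is witnessed by sign changes of the characteristic polynomial of
   A_J. An eigenvector of A_J is given by polynomials in the entries of A and the
   eigenvalue l; the signs deciding whether J produces l are signs of expressions
   affine in l, so it suffices to test them at the two endpoints of the interval.
   All tests are strict polynomial inequalities in the entries of A, so they persist
   on an open set containing A0; there the eigenvalues of A_J are pairwise distinct,
   hence simple, and the intervals that are to contain the produced ones are disjoint
   across supports. *)
Require Import Defs.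
From mathcomp Require Import all_boot all_order all_algebra.
From mathcomp Require Import all_classical all_reals all_analysis.
From mathcomp Require Import finmap ring lra.
Import Order.TTheory GRing.Theory Num.Theory.
Import numFieldNormedType.Exports.

Set Implicit Arguments.
Unset Strict Implicit.
Unset Printing Implicit Defensive.

Local Open Scope classical_set_scope.
Local Open Scope card_scope.
Local Open Scope ring_scope.

(** * Production by a support in terms of vectors indexed by all coordinates *)

Lemma submx_on_mul (R : realType) (n : nat) (A : 'M[R]_n) (I J : {set 'I_n})
    (x : 'cV[R]_n) :
  (forall i, i \notin J -> x i 0 = 0) ->
  submx_on A I J *m rowsub (fun k : 'I_#|J| => enum_val k) x =
  rowsub (fun k : 'I_#|I| => enum_val k) (A *m x).
Proof.
move=> x0; apply/colP => i; rewrite !mxE.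
under eq_bigr do rewrite !mxE.
rewrite -(big_enum_val (fun j => A (enum_val i) j * x j 0)) /=.
rewrite [RHS](bigID (mem J)) /= [X in _ = _ + X]big1 ?addr0// => j jJ.
by rewrite x0// mulr0.
Qed.

Lemma rowsub_enum_val_surj (R : realType) (n : nat) (J : {set 'I_n})
    (u : 'cV[R]_#|J|) :
  exists x : 'cV[R]_n, rowsub (fun k : 'I_#|J| => enum_val k) x = u /\
    forall i, i \notin J -> x i 0 = 0.
Proof.
(* The extension of [u] by zero: the sum has one term for [i] in [J] and none otherwise, since
   [enum_val] is injective. *)
exists (\col_i \sum_(k < #|J| | enum_val k == i) u k 0); split.
  apply/colP => k; rewrite !mxE (big_pred1 k)// => j /=.
  by rewrite (inj_eq enum_val_inj).
move=> i iJ; rewrite mxE big_pred0// => k.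
by apply/negbTE; apply: contra iJ => /eqP <-; exact: enum_valP.
Qed.

(** An eigenvector of the principal submatrix, extended by zero, so that coordinates are plain
    indices rather than positions in the enumeration of [J]. That it is nonzero is stated separately
    or follows from positivity. *)
Definition supported_eigenvector (R : realType) (n : nat) (A : 'M[R]_n)
    (J : {set 'I_n}) (l : R) (x : 'cV[R]_n) : Prop :=
  (forall i, i \notin J -> x i 0 = 0) /\
  (forall i, i \in J -> (A *m x) i 0 = l * x i 0).

Lemma produced_valuesE (R : realType) (n : nat) (A : 'M[R]_n)
    (J : {set 'I_n}) (l : R) :
  produced_values A J l <->
  J != finset.set0 /\ exists x, [/\ supported_eigenvector A J l x,
    forall i, i \in J -> 0 < x i 0 & forall i, i \notin J -> 0 <= (A *m x) i 0].
Proof.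
split=> [[u [J0 + + +]]|[J0 [x [[x0 Ax] xp Axp]]]].
  have [x [<- x0]] := rowsub_enum_val_surj u.
  rewrite !submx_on_mul// => /colP Ax xp Axp; split=> //; exists x; split=> //.
  - split=> // i iJ; have := Ax (enum_rank_in iJ i).
    by rewrite !mxE enum_rankK_in.
  - by move=> i iJ; have := xp (enum_rank_in iJ i); rewrite !mxE enum_rankK_in.
  - move=> i iJ; have iJc : i \in finset.setC J by rewrite finset.in_setC.
    by have := Axp (enum_rank_in iJc i); rewrite !mxE enum_rankK_in.
exists (rowsub (fun k : 'I_#|J| => enum_val k) x); split=> //.
- rewrite submx_on_mul//; apply/colP => k.
  by have := Ax _ (enum_valP k); rewrite !mxE.
- by move=> k; rewrite mxE xp//; exact: enum_valP.
- move=> k; rewrite submx_on_mul// mxE Axp//.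
  by have := enum_valP k; rewrite finset.in_setC.
Qed.

(** On [J] the residual [A *m x - l *: x] vanishes; off [J] the vector [x] vanishes and the residual
    equals [A *m x]. *)
Lemma produced_pareto (R : realType) (n : nat) (A : 'M[R]_n)
    (J : {set 'I_n}) (l : R) :
  produced_values A J l -> pareto_eigenvalue A l.
Proof.
move=> /produced_valuesE[/finset.set0Pn[j jJ] [x [[x0 Ax] xp Axp]]].
exists x; split.
- by apply/eqP => /colP/(_ j); rewrite mxE => xj; have := xp j jJ; rewrite xj ltxx.
- by move=> i; have [/xp/ltW//|/x0->] := boolP (i \in J).
- move=> i; rewrite [X in 0 <= X]mxE [X in _ + X]mxE [X in _ - X]mxE.
  have [iJ|iJ] := boolP (i \in J); first by rewrite Ax// subrr.
  by rewrite x0// mulr0 subr0 Axp.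
- apply: big1 => i _; rewrite [X in _ * X]mxE [X in _ + X]mxE [X in _ - X]mxE.
  have [iJ|iJ] := boolP (i \in J); first by rewrite Ax// subrr mulr0.
  by rewrite x0// mul0r.
Qed.

Lemma pareto_produced (R : realType) (n : nat) (A : 'M[R]_n) (l : R) :
  pareto_eigenvalue A l -> exists J, produced_values A J l.
Proof.
move=> [x [xN0 xge0 yge0]]; set y := A *m x - l *: x in yge0 *.
(* The inner product is a sum of nonnegative terms, so complementarity holds in each coordinate; the
   support is then the set of positive coordinates. *)
move=> /eqP; rewrite psumr_eq0; last by move=> i _; rewrite mulr_ge0.
move=> /allP xy0; have {}xy0 i : x i 0 * y i 0 = 0.
  by apply/eqP/xy0; rewrite mem_index_enum.
have yE i : y i 0 = (A *m x) i 0 - l * x i 0.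
  by rewrite [LHS]mxE [X in _ + X]mxE [X in _ - X]mxE.
exists [set i | 0 < x i 0]%SET; apply/produced_valuesE.
have x0 i : i \notin [set i | 0 < x i 0]%SET -> x i 0 = 0.
  by rewrite inE -leNgt => xi; apply/eqP; rewrite eq_le xi xge0.
split.
  apply: contra xN0 => /eqP J0; apply/eqP/colP => i; rewrite mxE x0//.
  by rewrite J0 finset.in_set0.
exists x; split; [split=> // i| |].
- rewrite inE => xi; have /eqP := xy0 i.
  by rewrite mulf_eq0 gt_eqF//= yE subr_eq0 => /eqP.
- by move=> i; rewrite inE.
- by move=> i iJ; have := yge0 i; rewrite yE x0// mulr0 subr0.
Qed.

(** * Principal submatrices with a full list of distinct eigenvalues *)

Lemma char_poly_tr (R : comNzRingType) (n : nat) (A : 'M[R]_n) :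
  char_poly A^T = char_poly A.
Proof.
rewrite /char_poly -det_tr; congr (\det _).
by apply/matrixP => i j; rewrite !mxE eq_sym.
Qed.

Section simple_spectrum.
Variables (R : realType) (n : nat) (A : 'M[R]_n) (J : {set 'I_n}).

Lemma root_char_poly_submx_on (l : R) (x : 'cV[R]_n) :
  x != 0 -> supported_eigenvector A J l x ->
  root (char_poly (submx_on A J J)) l.
Proof.
(* [eigenvalue] refers to row vectors, hence the passage to the transpose. *)
move=> xN0 [x0 Ax]; rewrite -char_poly_tr -eigenvalue_root_char.
apply/eigenvalueP; exists (rowsub (fun k : 'I_#|J| => enum_val k) x)^T.
  rewrite -trmx_mul submx_on_mul//; apply/rowP => k.
  by have := Ax _ (enum_valP k); rewrite !mxE.
apply: contra xN0 => /eqP/rowP xJ; apply/eqP/colP => i; rewrite [RHS]mxE.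
have [iJ|/x0//] := boolP (i \in J).
by have := xJ (enum_rank_in iJ i); rewrite !mxE enum_rankK_in.
Qed.

Variable S : seq R.
Hypotheses (S_uniq : uniq S) (S_size : size S = #|J|).
Hypothesis S_eigen : forall l, l \in S ->
  exists2 x, x != 0 & supported_eigenvector A J l x.

(** The monic characteristic polynomial has degree [#|J|] and the members of [S] are that many
    distinct roots, so it splits into simple factors. *)
Let char_polyE :
  char_poly (submx_on A J J) = \prod_(l <- S) ('X - l%:P).
Proof.
rewrite {1}[char_poly _](@all_roots_prod_XsubC _ _ S).
- by rewrite (monicP (char_poly_monic _)) scale1r.
- by rewrite size_char_poly S_size.
- by apply/allP => l /S_eigen[x x0 /(root_char_poly_submx_on x0)].
- by rewrite uniq_rootsE.
Qed.

Lemma produced_mem (l : R) : produced_values A J l -> l \in S.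
Proof.
move=> /produced_valuesE[/finset.set0Pn[j jJ] [x [Ax xp _]]].
rewrite -root_prod_XsubC -char_polyE; apply: root_char_poly_submx_on Ax.
by apply/eqP => /colP/(_ j); rewrite mxE => xj; have := xp j jJ; rewrite xj ltxx.
Qed.

Lemma regularly_produces_mem (l : R) (x : 'cV[R]_n) :
  J != finset.set0 -> l \in S -> supported_eigenvector A J l x ->
  (forall i, i \in J -> 0 < x i 0) ->
  (forall i, i \notin J -> 0 < (A *m x) i 0) -> regularly_produces A J l.
Proof.
move=> J0 lS [x0 Ax] xp Axp.
exists (rowsub (fun k : 'I_#|J| => enum_val k) x); split; first last.
- move=> k; rewrite submx_on_mul// mxE Axp//.
  by have := enum_valP k; rewrite finset.in_setC.
- by rewrite char_polyE mu_prod_XsubC count_uniq_mem// lS.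
- split=> //.
  + rewrite submx_on_mul//; apply/colP => k.
    by have := Ax _ (enum_valP k); rewrite !mxE.
  + by move=> k; rewrite mxE xp//; exact: enum_valP.
  + move=> k; rewrite submx_on_mul// mxE ltW// Axp//.
    by have := enum_valP k; rewrite finset.in_setC.
Qed.

End simple_spectrum.

(** * From a list of produced values to an assigned support map *)

Lemma card_mem_uniq (T : choiceType) (s : seq T) :
  uniq s -> [set` s] #= `I_(size s).
Proof.
move=> s_uniq.
have -> : [set` s] = [set` seq_fset tt s].
  by apply/seteqP; split=> x; rewrite /mkset seq_fsetE.
by apply/card_eq_fsetP; rewrite size_seq_fset undup_id.
Qed.

(** Each Pareto eigenvalue occurs in exactly one pair of [L], so [L] is the graph of a support map
    on the spectrum and its multiplicities are counts in [L]. *)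
Lemma assigned_of_enumeration (R : realType) (n : nat) (A : 'M[R]_n)
    (L : seq (R * {set 'I_n})) :
  uniq (map fst L) ->
  (forall z, z \in L -> regularly_produces A z.2 z.1) ->
  (forall J l, produced_values A J l -> l \in map fst L) ->
  [set l | regular_pareto_eigenvalue A l] #= `I_(size L) /\
  exists tau, assigned_support_map A tau /\
    forall J, assigned_multiplicity A tau J (count (fun z => z.2 == J) L).
Proof.
move=> L_uniq L_reg L_all.
have L_prod z : z \in L -> produced_values A z.2 z.1.
  by move=> /L_reg[u [? _ _]]; exists u.
have paretoE l : pareto_eigenvalue A l <-> l \in map fst L.
  split=> [/pareto_produced[J /L_all//]|/mapP[z zL ->]].
  exact: produced_pareto (L_prod _ zL).
split.
  rewrite -(size_map fst) (_ : [set l | _] = [set` map fst L]).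
    exact: card_mem_uniq.
  apply/seteqP; split=> l /= => [[/paretoE//]|lL]; split; first exact/paretoE.
  by have /mapP[z zL ->] := lL; exists z.2; exact: L_reg.
(* The default [set0] is reached only outside the Pareto spectrum. *)
pose tau l := nth finset.set0 (map snd L) (index l (map fst L)).
have tauE z : z \in L -> tau z.1 = z.2.
  move=> zL; rewrite /tau -[X in index X.1](nth_index z zL).
  rewrite -(nth_map _ z.1) ?index_mem// index_uniq ?size_map ?index_mem//.
  by rewrite (nth_map z) ?index_mem// nth_index.
exists tau; split=> [l /paretoE/mapP[z zL ->]|J].
  by rewrite tauE//; exact: L_prod.
rewrite /assigned_multiplicity -size_filter -(size_map fst).
rewrite (_ : [set l | _] = [set` map fst [seq z <- L | z.2 == J]]).
  by apply: card_mem_uniq; apply: subseq_uniq L_uniq; apply/map_subseq/filter_subseq.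
apply/seteqP; split=> l /=.
  move=> [/paretoE/mapP[z zL ->]]; rewrite tauE// => zJ.
  by apply: map_f; rewrite mem_filter zJ eqxx.
move=> /mapP[z]; rewrite mem_filter => /andP[/eqP zJ zL ->].
by split; [exact/paretoE/map_f|rewrite tauE].
Qed.

(** * Eigenvalues located in intervals with integer endpoints *)

Definition bracket : Type := (int * int)%type.

Definition in_bracket (R : realType) (l : R) (b : bracket) : bool :=
  (b.1%:~R < l) && (l < b.2%:~R).

Definition disjoint_brackets (b c : bracket) : bool :=
  (b.2 <= c.1) || (c.2 <= b.1).

Lemma in_disjoint_brackets (R : realType) (b c : bracket) (l : R) :
  disjoint_brackets b c -> in_bracket l b -> ~~ in_bracket l c.
Proof.
rewrite /in_bracket => /orP[]; rewrite -(ler_int R) => bc /andP[bl lb];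
  by apply/negP => /andP[cl lc]; lra.
Qed.

Lemma uniq_in_brackets (R : realType) (ls : seq R) (bs : seq bracket) :
  all2 (@in_bracket R) ls bs -> pairwise disjoint_brackets bs -> uniq ls.
Proof.
elim: ls bs => [|l ls IH] [|b bs]//= /andP[lb lsbs] /andP[b_bs bs_bs].
rewrite (IH bs)// andbT; elim: ls bs lsbs b_bs {IH bs_bs} => [|m ls IH] [|c bs]//=.
move=> /andP[mc lsbs] /andP[bc b_bs]; rewrite inE negb_or (IH bs)// andbT.
by apply: contraTneq mc => <-; exact: in_disjoint_brackets bc lb.
Qed.

(* The Boolean records whether the eigenvalue of [A_J] found in [b] is to be
   produced by [J]. *)
Definition certified (R : realType) (n : nat) (A : 'M[R]_n) (J : {set 'I_n})
    (b : bracket) (produced : bool) : Prop :=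
  exists2 l, in_bracket l b & exists x, [/\ x != 0, supported_eigenvector A J l x &
    if produced then
      (forall i, i \in J -> 0 < x i 0) /\ (forall i, i \notin J -> 0 < (A *m x) i 0)
    else ~ produced_values A J l].

Definition located (R : realType) (n : nat) (A : 'M[R]_n) (J : {set 'I_n})
    (bs : seq bracket) : Prop :=
  exists2 ls, all2 (@in_bracket R) ls bs &
    (forall l, l \in ls -> regularly_produces A J l) /\
    (forall l, produced_values A J l -> l \in ls).

(** The eigenvalues that are not produced matter as well: only with them does the list reach [#|J|]
    distinct eigenvalues, which makes it exhaustive and every member simple. *)
Lemma certified_located (R : realType) (n : nat) (A : 'M[R]_n)
    (J : {set 'I_n}) (c : seq (bracket * bool)) :
  J != finset.set0 -> size c = #|J| ->
  pairwise disjoint_brackets (map fst c) ->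
  (forall z, z \in c -> certified A J z.1 z.2) ->
  located A J [seq z.1 | z <- c & z.2].
Proof.
move=> J0 c_size c_disj c_cert.
have /choice[f fP] : forall z, exists l, z \in c -> in_bracket l z.1 /\
    exists x, [/\ x != 0, supported_eigenvector A J l x & if z.2 then
      (forall i, i \in J -> 0 < x i 0) /\ (forall i, i \notin J -> 0 < (A *m x) i 0)
      else ~ produced_values A J l].
  move=> z; have [/c_cert[l ? ?]|] := boolP (z \in c); first by exists l.
  by exists 0.
have all2_f s : {subset s <= c} -> all2 (@in_bracket R) (map f s) (map fst s).
  elim: s => [//|z s IH] sc /=; rewrite IH ?andbT; last first.
    by move=> y ys; apply: sc; rewrite inE ys orbT.
  by have [] := fP z (sc _ (mem_head _ _)).
have S_uniq : uniq (map f c) by apply: uniq_in_brackets (all2_f _ _) c_disj.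
have S_size : size (map f c) = #|J| by rewrite size_map.
have S_eigen l : l \in map f c -> exists2 x, x != 0 & supported_eigenvector A J l x.
  by move=> /mapP[z zc ->]; have [_ [x [? ? _]]] := fP z zc; exists x.
exists [seq f z | z <- c & z.2].
  by apply: all2_f => z; rewrite mem_filter => /andP[].
split=> l.
  move=> /mapP[z]; rewrite mem_filter => /andP[z2 zc] ->.
  have [_ [x [_ Ax +]]] := fP z zc; rewrite z2 => -[xp Axp].
  exact: (regularly_produces_mem S_uniq S_size S_eigen J0 (map_f f zc) Ax xp Axp).
move=> Jl; have /mapP[z zc lz] := produced_mem S_uniq S_size S_eigen Jl.
rewrite lz map_f// mem_filter zc andbT.
have [_ [x [_ _]]] := fP z zc; case: z.2 => // -[].
by rewrite -lz.
Qed.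

(** An interior value of an affine function is a convex combination of the endpoint values. Affinity
    is phrased through [f 0] and [f 1] so that [ring] can prove it for explicit expressions. *)
Lemma affine_gt0 (R : realFieldType) (f : R -> R) (s t x : R) :
  (forall y, f y = f 0 + (f 1 - f 0) * y) -> s < x -> x < t ->
  0 < f s -> 0 < f t -> 0 < f x.
Proof.
move=> fE sx xt fs ft.
have : 0 < (t - x) * f s + (x - s) * f t.
  by rewrite addr_gt0// mulr_gt0// subr_gt0.
rewrite (_ : _ + _ = (t - s) * f x); last by rewrite (fE s) (fE t) (fE x); ring.
by rewrite pmulr_rgt0// subr_gt0 (lt_trans sx).
Qed.

(** The intermediate value theorem; the strict sign change keeps the root away from both endpoints.
    The hypothesis has the shape [0 < _], like all the sign tests, for the sake of openness. *)
Lemma root_in_bracket (R : realType) (p : {poly R}) (b : bracket) :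
  b.1 < b.2 -> 0 < - (p.[b.1%:~R] * p.[b.2%:~R]) ->
  exists2 l, in_bracket l b & p.[l] = 0.
Proof.
rewrite -(ltr_int R); set s := b.1%:~R; set t := b.2%:~R => st pst.
(* Passing to [- p] preserves the roots and the product of the endpoint values. *)
wlog ps : p pst / p.[s] < 0 => [IH|].
  have [|ps|ps0] := ltgtP p.[s] 0; first exact: IH.
    have [||l lb] := IH (- p); rewrite ?hornerN ?mulrNN ?oppr_lt0// => /eqP.
    by rewrite oppr_eq0 => /eqP; exists l.
  by move: pst; rewrite ps0 mul0r oppr0 ltxx.
have pt : 0 < p.[t] by move: pst; rewrite -mulNr pmulr_rgt0// oppr_gt0.
have [|l /andP[sl lt] /rootP pl] := @Num.Theory.poly_ivt _ p s t (ltW st).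
  by rewrite !ltW.
exists l => //; rewrite /in_bracket -/s -/t !lt_neqAle sl lt !andbT.
apply/andP; split; apply/eqP => E; first by move: ps; rewrite E pl ltxx.
by move: pt; rewrite -E pl ltxx.
Qed.

(** * Sign tests for the supports of a matrix of order three *)

Section order_three.
Variables (R : realType) (A : 'M[R]_3).
Implicit Types (i j k : 'I_3) (l s t : R) (b : bracket).

(** Keeping the three indices as an arbitrary permutation lets one sign test serve all supports of
    the same size. *)
Lemma ord3_ind i j k (P : 'I_3 -> Prop) :
  uniq [:: i; j; k] -> P i -> P j -> P k -> forall m, P m.
Proof.
move=> ijk Pi Pj Pk m.
have : m \in [:: i; j; k].
  by rewrite (subset_cardP _ (subset_predT _))// (card_uniqP ijk) card_ord.
by rewrite !inE => /or3P[] /eqP ->.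
Qed.

Lemma mulmx3E i j k (x : 'cV[R]_3) (m : 'I_3) : uniq [:: i; j; k] ->
  (A *m x) m 0 = A m i * x i 0 + A m j * x j 0 + A m k * x k 0.
Proof.
move=> ijk; rewrite mxE -big_enum /= (perm_big [:: i; j; k]).
  by rewrite !big_cons big_nil /= addr0 addrA.
apply: uniq_perm => //; first exact: enum_uniq.
by apply: (ord3_ind ijk); rewrite mem_enum !inE eqxx ?orbT.
Qed.

Definition col3 i j (a b c : R) : 'cV[R]_3 :=
  \col_m (if m == i then a else if m == j then b else c).

Lemma col3E i j k (a b c : R) : uniq [:: i; j; k] ->
  (col3 i j a b c i 0 = a) * (col3 i j a b c j 0 = b) * (col3 i j a b c k 0 = c).
Proof.
rewrite /= !inE negb_or !andbT => /andP[/andP[ij ik] jk].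
by rewrite !mxE !eqxx eq_sym (negbTE ij) ![k == _]eq_sym (negbTE ik) (negbTE jk).
Qed.

Lemma cVN0 (x : 'cV[R]_3) i : x i 0 != 0 -> x != 0.
Proof. by apply: contra => /eqP ->; rewrite mxE. Qed.

(** The eigenvalue is [A i i] itself, with the coordinate vector as eigenvector. Rejection looks at
    row [j] only, so the order of [j] and [k] matters. *)
Definition cert1 i j k b (produced : bool) : Prop :=
  0 < A i i - b.1%:~R /\ 0 < b.2%:~R - A i i /\
  if produced then 0 < A j i /\ 0 < A k i else 0 < - A j i.

Lemma cert1_certified i j k b produced : uniq [:: i; j; k] ->
  cert1 i j k b produced -> certified A [set i]%SET b produced.
Proof.
move=> ijk [b1 [b2 H]].
have E x m := mulmx3E x m ijk; have xE a c d := col3E a c d ijk.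
have [ji ki] : j != i /\ k != i.
  by move: ijk; rewrite /= !inE negb_or ![i == _]eq_sym => /andP[/andP[]].
exists (A i i); first by apply/andP; split; lra.
exists (col3 i j 1 0 0); split.
- by apply: (@cVN0 _ i); rewrite xE oner_eq0.
- split; apply: (ord3_ind ijk); rewrite ?inE ?eqxx ?(negbTE ji) ?(negbTE ki) ?E ?xE //.
  by move=> _; ring.
- case: produced H => [[Aji Aki]|Aji].
    split; apply: (ord3_ind ijk);
      rewrite ?inE ?eqxx ?(negbTE ji) ?(negbTE ki) ?E ?xE //; lra.
  move=> /produced_valuesE[_ [x [[x0 _] xp Axp]]].
  have := Axp j; rewrite inE ji E (x0 j) ?inE// (x0 k) ?inE// !mulr0 !addr0 => /(_ isT).
  have xi : 0 < x i 0 by rewrite xp// inE.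
  by rewrite leNgt -oppr_gt0 -mulNr mulr_gt0.
Qed.

Definition charpoly2 i j l : R := (l - A i i) * (l - A j j) - A i j * A j i.

(* An eigenvector of [A_{i,j}] for [l] is [(A i j, l - A i i)]; it is used here
   multiplied by [A i j]. *)
Definition cert2 i j k b (produced : bool) : Prop :=
  0 < - (charpoly2 i j b.1%:~R * charpoly2 i j b.2%:~R) /\
  let sign l := if produced
    then 0 < A i j * (l - A i i) /\
         0 < A i j * (A k i * A i j + A k j * (l - A i i))
    else 0 < A i j * (A i i - l) in
  sign b.1%:~R /\ sign b.2%:~R.

Lemma cert2_certified i j k b produced : uniq [:: i; j; k] -> b.1 < b.2 ->
  cert2 i j k b produced -> certified A [set i; j]%SET b produced.
Proof.
move=> ijk b12 [bp H].
have E x m := mulmx3E x m ijk; have xE a c d := col3E a c d ijk.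
have [[ij ki] kj] : ((i == j) = false /\ (k == i) = false) /\ (k == j) = false.
  move: ijk; rewrite /= !inE negb_or ![k == _]eq_sym.
  by do 2 case: eqVneq => // _; case: eqVneq.
have ji : (j == i) = false by rewrite eq_sym.
pose p : {poly R} := ('X - (A i i)%:P) * ('X - (A j j)%:P) - (A i j * A j i)%:P.
have pE l : p.[l] = charpoly2 i j l by rewrite /p !hornerE.
have [|l lb] := @root_in_bracket _ p b b12; first by rewrite !pE.
rewrite pE /charpoly2 => pl; have /andP[b1l lb2] := lb.
(* The extra factor [A i j] makes the first component a square, so only the second needs a sign
   test. *)
exists l => //; exists (col3 i j (A i j * A i j) (A i j * (l - A i i)) 0).
(* Every sign test carries the factor [A i j], so its strictness excludes zero. *)
have Aij : A i j != 0.
  apply/eqP => Aij; move: H; rewrite /= Aij !mul0r.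
  by case: produced; rewrite ltxx => -[] // [].
split.
- by apply: (@cVN0 _ i); rewrite xE mulf_neq0.
- split; apply: (ord3_ind ijk);
    rewrite ?inE ?eqxx ?ij ?ji ?ki ?kj ?E ?xE //= => _; first by ring.
  rewrite mulr0 addr0; apply: subr0_eq.
  by rewrite -[RHS](mulr0 (- A i j)) -pl; ring.
- case: produced H => [[[s1 s2] [t1 t2]]|[s1 t1]].
    have sl : 0 < A i j * (l - A i i).
      apply: (affine_gt0 (f := fun l => A i j * (l - A i i)) _ b1l lb2) => // y.
      by ring.
    have tl : 0 < A i j * (A k i * A i j + A k j * (l - A i i)).
      apply: (affine_gt0 (f := fun l => A i j * (A k i * A i j + A k j * (l - A i i)))
        _ b1l lb2) => // y; ring.
    split; apply: (ord3_ind ijk);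
      rewrite ?inE ?eqxx ?ij ?ji ?ki ?kj ?E ?xE //= => _; last by lra.
    by rewrite -expr2 exprn_even_gt0.
  move=> /produced_valuesE[_ [x [[x0 Ax] xp _]]].
  have := Ax i; rewrite !inE eqxx E (x0 k) ?inE ?ki ?kj// => /(_ isT) Axi.
  have xi : 0 < x i 0 by rewrite xp// !inE eqxx.
  have xj : 0 < x j 0 by rewrite xp// !inE eqxx orbT.
  have sl : 0 < A i j * (A i i - l).
    by apply: (affine_gt0 (f := fun l => A i j * (A i i - l)) _ b1l lb2) => // y; ring.
  (* Row [i] of the eigenvalue equation, times [A i j], says that this sum is zero. *)
  have : 0 < A i j * (A i i - l) * x i 0 + A i j * A i j * x j 0.
    by apply: addr_gt0; apply: mulr_gt0 => //; rewrite -expr2 exprn_even_gt0.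
  rewrite (_ : _ + _ = A i j * (A i i * x i 0 + A i j * x j 0 + A i k * 0 - l * x i 0)).
    by rewrite Axi subrr mulr0 ltxx.
  by ring.
Qed.

(** The determinant of [l - A], expanded along row [k]. *)
Definition charpoly3 i j k l : R :=
  (l - A k k) * charpoly2 i j l - A k i * (A i j * A j k + A i k * (l - A j j))
  - A k j * (A j i * A i k + A j k * (l - A i i)).

Definition cross i j k l : R := A i k * (A j j - l) - A i j * A j k.

(* An eigenvector of [A] for [l] is the cross product of the rows [i] and [j] of
   [A - l], which up to sign is
   [(cross i j k l, cross j i k l, - charpoly2 i j l)]; its last component is not
   affine in [l], but the last row of the eigenvalue equation gives its sign. *)
Definition cert3 i j k b (produced : bool) : Prop :=
  0 < - (charpoly3 i j k b.1%:~R * charpoly3 i j k b.2%:~R) /\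
  let sign l := if produced
    then 0 < cross i j k l /\ 0 < cross j i k l /\
         0 < A k i * cross i j k l + A k j * cross j i k l /\ 0 < l - A k k
    else 0 < - cross i j k l /\ 0 < cross j i k l in
  sign b.1%:~R /\ sign b.2%:~R.

Lemma cert3_certified i j k b produced : uniq [:: i; j; k] -> b.1 < b.2 ->
  cert3 i j k b produced -> certified A [set i; j; k]%SET b produced.
Proof.
move=> ijk b12 [bp H].
have E x m := mulmx3E x m ijk; have xE a c d := col3E a c d ijk.
have J m : m \in [set i; j; k]%SET.
  by move: m; apply: (ord3_ind ijk); rewrite !inE eqxx ?orbT.
pose p : {poly R} := ('X - (A k k)%:P) *
    (('X - (A i i)%:P) * ('X - (A j j)%:P) - (A i j * A j i)%:P)
  - (A k i)%:P * ((A i j * A j k)%:P + (A i k)%:P * ('X - (A j j)%:P))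
  - (A k j)%:P * ((A j i * A i k)%:P + (A j k)%:P * ('X - (A i i)%:P)).
have pE l : p.[l] = charpoly3 i j k l by rewrite /p !hornerE.
have [|l lb] := @root_in_bracket _ p b b12; first by rewrite !pE.
rewrite pE => pl; have /andP[b1l lb2] := lb.
(* Tested in both cases, because it also shows that the candidate eigenvector is nonzero. *)
have cj : 0 < cross j i k l.
  apply: (affine_gt0 (f := cross j i k) _ b1l lb2).
      by move=> y; rewrite /cross; ring.
    by case: produced H => [[[_ []]]|[[]]].
  by case: produced H => [[_ [_ []]]|[_ []]].
exists l => //; exists (col3 i j (cross i j k l) (cross j i k l) (- charpoly2 i j l)).
have Ax : supported_eigenvector A [set i; j; k]%SET l
    (col3 i j (cross i j k l) (cross j i k l) (- charpoly2 i j l)).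
  split=> m; first by rewrite J.
  move=> _; move: m; apply: (ord3_ind ijk); rewrite E !xE.
  - by rewrite /cross /charpoly2; ring.
  - by rewrite /cross /charpoly2; ring.
  - apply: subr0_eq; rewrite -pl /charpoly3 /cross; ring.
split=> //; first by apply: (@cVN0 _ j); rewrite xE gt_eqF.
case: produced H => [[[ci1 [_ [ck1 d1]]] [ci2 [_ [ck2 _]]]]|[[ci1 _] [ci2 _]]].
  have ci : 0 < cross i j k l.
    by apply: (affine_gt0 (f := cross i j k) _ b1l lb2) => // y; rewrite /cross; ring.
  have ck : 0 < A k i * cross i j k l + A k j * cross j i k l.
    apply: (affine_gt0 (f := fun l => A k i * cross i j k l + A k j * cross j i k l)
      _ b1l lb2) => // y; rewrite /cross; ring.
  have d : 0 < l - A k k by lra.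
  have q : 0 < - charpoly2 i j l.
    rewrite -(pmulr_rgt0 _ d) mulrN.
    suff -> : (l - A k k) * charpoly2 i j l =
      - (A k i * cross i j k l + A k j * cross j i k l) by rewrite opprK.
    apply: subr0_eq; rewrite -pl /charpoly3 /cross; ring.
  split=> m; last by rewrite J.
  by move=> _; move: m; apply: (ord3_ind ijk); rewrite xE.
have ci : 0 < - cross i j k l.
  apply: (affine_gt0 (f := fun l => - cross i j k l) _ b1l lb2) => // y.
  by rewrite /cross; ring.
(* Eliminating [y k 0] from rows [i] and [j] leaves a relation between [y i 0] and [y j 0] whose
   coefficients have the same sign, impossible for positive [y]. *)
move=> /produced_valuesE[_ [y [[_ Ay] yp _]]].
have := Ay i (J i); have := Ay j (J j); rewrite !E => Ej Ei.
have : 0 < - cross i j k l * y j 0 + cross j i k l * y i 0.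
  by apply: addr_gt0; apply: mulr_gt0 => //; exact: yp.
rewrite (_ : _ + _ =
  A j k * (A i i * y i 0 + A i j * y j 0 + A i k * y k 0 - l * y i 0)
  - A i k * (A j i * y i 0 + A j j * y j 0 + A j k * y k 0 - l * y j 0)).
  by rewrite Ei Ej !subrr !mulr0 subrr ltxx.
by rewrite /cross; ring.
Qed.

End order_three.

(** * The sign tests are open conditions *)

Section openness.
Variable R : realType.
Implicit Types (f g : 'M[R]_3 -> R) (P Q : 'M[R]_3 -> Prop).

(** The constructors mirror the syntax of the sign tests, so membership is proved by recursion on
    the expression. *)
Inductive entry_polynomial : ('M[R]_3 -> R) -> Prop :=
| entry_polynomial_coord i j : entry_polynomial (fun A => A i j)
| entry_polynomial_const c : entry_polynomial (fun=> c)
| entry_polynomial_add f g : entry_polynomial f -> entry_polynomial g ->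
    entry_polynomial (fun A => f A + g A)
| entry_polynomial_mul f g : entry_polynomial f -> entry_polynomial g ->
    entry_polynomial (fun A => f A * g A)
| entry_polynomial_opp f : entry_polynomial f -> entry_polynomial (fun A => - f A).

Lemma entry_polynomial_continuous f : entry_polynomial f -> continuous f.
Proof.
elim=> [i j|c|{}f g _ cf _ cg A|{}f g _ cf _ cg A|{}f _ cf A].
- exact: coord_continuous.
- exact: cst_continuous.
- by apply: continuousD; [exact: cf|exact: cg].
- by apply: continuousM; [exact: cf|exact: cg].
- by apply: continuousN; exact: cf.
Qed.

Lemma open_gt0 f : entry_polynomial f -> open [set A | 0 < f A].
Proof.
move=> /entry_polynomial_continuous cf.
by apply: (@open_comp _ _ f [set x | 0 < x]) (open_gt (y := 0)) => A _; exact: cf.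
Qed.

Lemma open_and P Q : open [set A | P A] -> open [set A | Q A] ->
  open [set A | P A /\ Q A].
Proof. exact: openI. Qed.

Lemma open_forall_in (T : eqType) (s : seq T) (P : T -> 'M[R]_3 -> Prop) :
  (forall z, open [set A | P z A]) ->
  open [set A | forall z, z \in s -> P z A].
Proof.
move=> oP; elim: s => [|z s IH].
  by rewrite (_ : [set A | _] = setT)//; [exact: openT|apply/seteqP; split].
rewrite (_ : [set A | _] = [set A | P z A /\ forall y, y \in s -> P y A]).
  exact: open_and.
apply/seteqP; split=> A /= => [H|[Pz Ps] y].
  by split=> [|y ys]; apply: H; rewrite inE ?eqxx ?ys ?orbT.
by rewrite inE => /orP[/eqP ->|/Ps].
Qed.

(* Each constructor is selected by the head symbol: letting unification try them
   in turn unfolds the ring operations and is very slow. *)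
Local Ltac prove_entry_polynomial :=
  lazymatch goal with
  | |- entry_polynomial (fun A => @?f A + @?g A) =>
    apply: (@entry_polynomial_add f g); prove_entry_polynomial
  | |- entry_polynomial (fun A => @?f A * @?g A) =>
    apply: (@entry_polynomial_mul f g); prove_entry_polynomial
  | |- entry_polynomial (fun A => - @?f A) =>
    apply: (@entry_polynomial_opp f); prove_entry_polynomial
  | |- entry_polynomial (fun A => fun_of_matrix A ?i ?j) =>
    exact: (entry_polynomial_coord i j)
  | |- entry_polynomial (fun=> ?c) => exact: (entry_polynomial_const c)
  end.

Local Ltac open_polynomial :=
  lazymatch goal with
  | |- open [set A | @?P A /\ @?Q A] =>
    apply: (@open_and P Q); cbv beta; open_polynomial
  | _ => apply: open_gt0; prove_entry_polynomial
  end.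

Lemma open_cert1 (i j k : 'I_3) (b : bracket) (produced : bool) :
  open [set A : 'M[R]_3 | cert1 A i j k b produced].
Proof. by case: produced; rewrite /cert1 /=; open_polynomial. Qed.

Lemma open_cert2 (i j k : 'I_3) (b : bracket) (produced : bool) :
  open [set A : 'M[R]_3 | cert2 A i j k b produced].
Proof. by case: produced; rewrite /cert2 /charpoly2 /=; open_polynomial. Qed.

Lemma open_cert3 (i j k : 'I_3) (b : bracket) (produced : bool) :
  open [set A : 'M[R]_3 | cert3 A i j k b produced].
Proof.
by case: produced; rewrite /cert3 /charpoly3 /charpoly2 /cross /=; open_polynomial.
Qed.

End openness.

(** * Certificates for detailed profiles *)

Local Notation i1 := (@Ordinal 3 0 isT).
Local Notation i2 := (@Ordinal 3 1 isT).
Local Notation i3 := (@Ordinal 3 2 isT).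

(** Reduces comparison of explicit supports to membership tests that simplification can decide. *)
Lemma set3_eq (J K : {set 'I_3}) :
  (J == K) = [&& (i1 \in J) == (i1 \in K), (i2 \in J) == (i2 \in K)
    & (i3 \in J) == (i3 \in K)].
Proof.
apply/eqP/idP => [->|/and3P[/eqP J1 /eqP J2 /eqP J3]]; first by rewrite !eqxx.
by apply/setP; apply: (@ord3_ind i1 i2 i3).
Qed.

Lemma support3_cases (J : {set 'I_3}) : J != finset.set0 ->
  J \in [:: [set i1]; [set i2]; [set i3]; [set i1; i2]; [set i1; i3];
            [set i2; i3]; [set i1; i2; i3]]%SET.
Proof.
rewrite !inE !set3_eq !inE /=.
by case: (i1 \in J); case: (i2 \in J); case: (i3 \in J).
Qed.

Lemma all2_cat_in_bracket (R : realType) (ls ms : seq R) (bs cs : seq bracket) :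
  all2 (@in_bracket R) ls bs -> all2 (@in_bracket R) ms cs ->
  all2 (@in_bracket R) (ls ++ ms) (bs ++ cs).
Proof.
by elim: ls bs => [|l ls IH] [|b bs]//= /andP[-> lsbs] mscs; rewrite IH.
Qed.

Lemma size_all2 (S T : Type) (r : S -> T -> bool) (s : seq S) (t : seq T) :
  all2 r s t -> size s = size t.
Proof. by rewrite all2E => /andP[/eqP]. Qed.

(** Tagging each value with its support and concatenating gives the enumeration; disjointness of
    brackets across supports prevents a value from being listed twice. *)
Lemma located_profile (R : realType) (A : 'M[R]_3)
    (b1 b2 b3 b12 b13 b23 b123 : seq bracket) :
  pairwise disjoint_brackets (b1 ++ b2 ++ b3 ++ b12 ++ b13 ++ b23 ++ b123) ->
  located A [set i1]%SET b1 -> located A [set i2]%SET b2 ->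
  located A [set i3]%SET b3 -> located A [set i1; i2]%SET b12 ->
  located A [set i1; i3]%SET b13 -> located A [set i2; i3]%SET b23 ->
  located A [set i1; i2; i3]%SET b123 ->
  [set l | regular_pareto_eigenvalue A l] #=
    `I_(size (b1 ++ b2 ++ b3 ++ b12 ++ b13 ++ b23 ++ b123)) /\
  exists tau, assigned_support_map A tau /\
    has_detailed_profile A tau ((size b1, size b2, size b3),
      (size b12, size b13, size b23), size b123).
Proof.
move=> b_disj [l1 lb1 [r1 p1]] [l2 lb2 [r2 p2]] [l3 lb3 [r3 p3]]
  [l12 lb12 [r12 p12]] [l13 lb13 [r13 p13]] [l23 lb23 [r23 p23]]
  [l123 lb123 [r123 p123]].
pose tag (J : {set 'I_3}) (ls : seq R) := [seq (l, J) | l <- ls].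
pose L := tag [set i1]%SET l1 ++ tag [set i2]%SET l2 ++ tag [set i3]%SET l3 ++
  tag [set i1; i2]%SET l12 ++ tag [set i1; i3]%SET l13 ++
  tag [set i2; i3]%SET l23 ++ tag [set i1; i2; i3]%SET l123.
have fst_tag J ls : map fst (tag J ls) = ls by rewrite -map_comp map_id.
have fstL : map fst L = l1 ++ l2 ++ l3 ++ l12 ++ l13 ++ l23 ++ l123.
  by rewrite /L !map_cat !fst_tag.
have lb : all2 (@in_bracket R) (map fst L)
    (b1 ++ b2 ++ b3 ++ b12 ++ b13 ++ b23 ++ b123).
  by rewrite fstL; do 6 apply: all2_cat_in_bracket => //.
have count_tag J K ls : count (fun z => z.2 == J) (tag K ls) = ((K == J) * size ls)%N.
  by rewrite count_map; elim: ls => [|l ls /= ->]; rewrite ?muln0// mulnS.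
have [||J l Jl|card_reg [tau [Atau m_tau]]] := @assigned_of_enumeration R 3 A L.
- exact: uniq_in_brackets lb b_disj.
- move=> z; rewrite /L !mem_cat.
  by do ?[case/orP]; move=> /mapP[l ll ->] /=;
    [exact: r1|exact: r2|exact: r3|exact: r12|exact: r13|exact: r23|exact: r123].
- have /produced_valuesE[/support3_cases J_cases _] := Jl.
  rewrite fstL !mem_cat; move: J_cases Jl; rewrite !inE.
  by do ?[case/orP]; move=> /eqP ->;
    [move/p1|move/p2|move/p3|move/p12|move/p13|move/p23|move/p123] => ->; rewrite ?orbT.
- split; first by rewrite -(size_all2 lb) size_map.
  exists tau; split=> //.
  have {}m_tau J m : count (fun z => z.2 == J) L = m -> assigned_multiplicity A tau J m.
    by move=> <-.
  have sz := (size_all2 lb1, size_all2 lb2, size_all2 lb3, size_all2 lb12,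
    size_all2 lb13, size_all2 lb23, size_all2 lb123).
  (* Lists tagged with another support count zero, so a single size survives. *)
  by split; [split|split|]; apply: m_tau;
    rewrite /L !count_cat !count_tag !set3_eq !inE /= ?mul0n ?mul1n ?addn0 ?add0n -!sz.
Qed.

(* The brackets of the eigenvalues of each principal submatrix, flagged according
   to whether the eigenvalue is to be produced. *)
Record certificate : Type := Certificate {
  on1 : seq (bracket * bool); on2 : seq (bracket * bool); on3 : seq (bracket * bool);
  on12 : seq (bracket * bool); on13 : seq (bracket * bool); on23 : seq (bracket * bool);
  on123 : seq (bracket * bool) }.

Definition producing (c : seq (bracket * bool)) : seq bracket :=
  [seq z.1 | z <- c & z.2].

Definition all_producing (C : certificate) : seq bracket :=
  producing (on1 C) ++ producing (on2 C) ++ producing (on3 C) ++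
  producing (on12 C) ++ producing (on13 C) ++ producing (on23 C) ++
  producing (on123 C).

(** The part of the verification that does not involve the matrix, decided by computation. Across
    supports only producing brackets must be disjoint: eigenvalues that are not produced may share
    intervals. *)
Definition well_formed (C : certificate) : bool :=
  let ok k c := [&& size c == k, all (fun z : bracket * bool => z.1.1 < z.1.2) c
    & pairwise disjoint_brackets (map fst c)] in
  [&& ok 1%N (on1 C), ok 1%N (on2 C), ok 1%N (on3 C), ok 2%N (on12 C), ok 2%N (on13 C),
      ok 2%N (on23 C), ok 3%N (on123 C)
    & pairwise disjoint_brackets (all_producing C)].

Definition certificate_profile (C : certificate) : profile3 :=
  let m c := size (producing c) in
  ((m (on1 C), m (on2 C), m (on3 C)), (m (on12 C), m (on13 C), m (on23 C)),
   m (on123 C)).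

(** The index order for singletons is cyclic: it puts a negative entry in the row used for rejection
    in each of the three matrices below. *)
Definition certifies (R : realType) (C : certificate) (A : 'M[R]_3) : Prop :=
  (forall z, z \in on1 C -> cert1 A i1 i2 i3 z.1 z.2) /\
  (forall z, z \in on2 C -> cert1 A i2 i3 i1 z.1 z.2) /\
  (forall z, z \in on3 C -> cert1 A i3 i1 i2 z.1 z.2) /\
  (forall z, z \in on12 C -> cert2 A i1 i2 i3 z.1 z.2) /\
  (forall z, z \in on13 C -> cert2 A i1 i3 i2 z.1 z.2) /\
  (forall z, z \in on23 C -> cert2 A i2 i3 i1 z.1 z.2) /\
  (forall z, z \in on123 C -> cert3 A i1 i2 i3 z.1 z.2).

Lemma open_certifies (R : realType) (C : certificate) :
  open [set A : 'M[R]_3 | certifies C A].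
Proof.
do 6 (apply: open_and;
  first by apply: open_forall_in => z; first [exact: open_cert1|exact: open_cert2]).
by apply: open_forall_in => z; exact: open_cert3.
Qed.

Lemma certified_profile (R : realType) (C : certificate) (A : 'M[R]_3) :
  well_formed C -> certifies C A ->
  [set l | regular_pareto_eigenvalue A l] #=
    `I_(size (all_producing C)) /\
  exists tau, assigned_support_map A tau /\
    has_detailed_profile A tau (certificate_profile C).
Proof.
move=> /andP[/and3P[/eqP s1 /allP b1 d1]] /andP[/and3P[/eqP s2 /allP b2 d2]]
  /andP[/and3P[/eqP s3 /allP b3 d3]] /andP[/and3P[/eqP s12 /allP b12 d12]]
  /andP[/and3P[/eqP s13 /allP b13 d13]] /andP[/and3P[/eqP s23 /allP b23 d23]]
  /andP[/and3P[/eqP s123 /allP b123 d123] disj].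
move=> [h1 [h2 [h3 [h12 [h13 [h23 h123]]]]]].
have card_all : #|[set i1; i2; i3]%SET| = 3%N.
  by rewrite (_ : [set i1; i2; i3]%SET = [set: 'I_3]%SET) ?cardsT ?card_ord//;
    apply/eqP; rewrite set3_eq !inE.
apply: located_profile => //; apply: certified_located => //;
  rewrite ?set3_eq ?inE ?cards1 ?cards2 ?card_all //.
- by move=> z zc; apply: cert1_certified (h1 z zc).
- by move=> z zc; apply: cert1_certified (h2 z zc).
- by move=> z zc; apply: cert1_certified (h3 z zc).
- by move=> z zc; apply: cert2_certified (h12 z zc) => //; exact: b12.
- by move=> z zc; apply: cert2_certified (h13 z zc) => //; exact: b13.
- by move=> z zc; apply: cert2_certified (h23 z zc) => //; exact: b23.
- by move=> z zc; apply: cert3_certified (h123 z zc) => //; exact: b123.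
Qed.

(** * The three explicit matrices and their neighbourhoods *)

Definition mx3 (R : realType) (rows : seq (seq R)) : 'M[R]_3 :=
  \matrix_(i < 3, j < 3) (nth [::] rows i)`_j.

Lemma profile_neighbourhood (R : realType) (C : certificate) (A0 : 'M[R]_3) :
  well_formed C -> certifies C A0 ->
  size (all_producing C) = 9%N ->
  exists V : set 'M[R]_3,
    [/\ V !=set0, open V
      & forall A : 'M[R]_3, V A ->
          [set l | regular_pareto_eigenvalue A l] #= `I_9 /\
          exists tau : R -> {set 'I_3},
            assigned_support_map A tau /\
            has_detailed_profile A tau (certificate_profile C)].
Proof.
move=> wfC A0C sizeC; exists [set A | certifies C A]; split.
- by exists A0.
- exact: open_certifies.
- by move=> A /(certified_profile wfC); rewrite sizeC.
Qed.

(* A unit interval around each irrational eigenvalue and an interval of length 2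
   centred at each diagonal entry of a matrix found by computer search. *)
Definition certificate1 : certificate := {|
  on1 := [:: ((24, 26), true)]; on2 := [:: ((-25, -23), false)];
  on3 := [:: ((-19, -17), false)];
  on12 := [:: ((-26, -25), false); ((26, 27), true)];
  on13 := [:: ((-2, -1), true); ((8, 9), true)];
  on23 := [:: ((-23, -22), true); ((-20, -19), true)];
  on123 := [:: ((-17, -16), true); ((-16, -15), true); ((15, 16), true)] |}.

Definition certificate2 : certificate := {|
  on1 := [:: ((16, 18), true)]; on2 := [:: ((-17, -15), true)];
  on3 := [:: ((-18, -16), false)];
  on12 := [:: ((-18, -17), false); ((18, 19), true)];
  on13 := [:: ((-5, -4), true); ((4, 5), true)];
  on23 := [:: ((-19, -18), false); ((-15, -14), true)];
  on123 := [:: ((-13, -12), true); ((-12, -11), true); ((8, 9), true)] |}.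

Definition certificate3 : certificate := {|
  on1 := [:: ((-3, -1), true)]; on2 := [:: ((3, 5), true)];
  on3 := [:: ((-9, -7), false)];
  on12 := [:: ((-9, -8), false); ((10, 11), true)];
  on13 := [:: ((-7, -6), true); ((-4, -3), true)];
  on23 := [:: ((-5, -4), true); ((0, 1), true)];
  on123 := [:: ((-9, -8), false); ((-6, -5), true); ((8, 9), true)] |}.

(** For an explicit integer matrix every test unfolds to an inequality between numerals. *)
Local Ltac check_certificate :=
  do ?[apply: conj]; move=> z; rewrite /= !inE; do ?[case/orP]; move=> /eqP ->;
  rewrite /cert1 /cert2 /cert3 /charpoly3 /charpoly2 /cross /= !mxE /=;
  repeat split; lra.

Lemma certifies_certificate1 (R : realType) :
  certifies certificate1
    (mx3 [:: [:: 25; 16; -21]; [:: 4; -24; 7]; [:: 21; -1; -18]] : 'M[R]_3).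
Proof. check_certificate. Qed.

Lemma certifies_certificate2 (R : realType) :
  certifies certificate2
    (mx3 [:: [:: 17; 7; -17]; [:: 5; -16; 5]; [:: 16; 1; -17]] : 'M[R]_3).
Proof. check_certificate. Qed.

Lemma certifies_certificate3 (R : realType) :
  certifies certificate3
    (mx3 [:: [:: -2; 9; -6]; [:: 9; 4; -7]; [:: 1; 4; -8]] : 'M[R]_3).
Proof. check_certificate. Qed.

Theorem proposition7p1 (R : realType) (p : profile3)
    (hp : [\/ p = ((1, 0, 0), (1, 2, 2), 3)%N,
              p = ((1, 1, 0), (1, 2, 1), 3)%N
            | p = ((1, 1, 0), (1, 2, 2), 2)%N]) :
  exists V : set 'M[R]_3,
    [/\ V !=set0, open V
      & forall A : 'M[R]_3, V A ->
          [set l | regular_pareto_eigenvalue A l] #= `I_9 /\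
          exists tau : R -> {set 'I_3},
            assigned_support_map A tau /\ has_detailed_profile A tau p].
Proof.
(* Well-formedness, the total of nine and the profile itself are obtained by evaluating each
   certificate. *)
case: hp => ->.
- exact: profile_neighbourhood (certifies_certificate1 R) _.
- exact: profile_neighbourhood (certifies_certificate2 R) _.
- exact: profile_neighbourhood (certifies_certificate3 R) _.
Qed.
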